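(* Let $n$ be a positive integer, let $\phi: B_n \to \mathbb{R}$ be a function, and let $G=(V,E)$ be a partial order of the $n$ binary variables $x_1,\dots,x_n$ that is valid with respect to minimization of $\phi$. Then, for any non-negative function $c: E\times B_n \to \mathbb{R}$, we have $$\min_{x\in B_n} \phi(x) = \min_{x\in B_n} \Bigl( \phi(x) + \sum_{e=(x_i,x_j)\in E} c(e, x)\,(x_i - x_i x_j) \Bigr).$$ Moreover, if $x^* \in B_n$ attains the minimum of the right-hand side, then it attains the minimum of the left-hand side.
   Context: $B_n := \{0,1\}^n$. A partial order of $n$ binary variables $x=(x_1,\dots,x_n)$ is a directed acyclic graph $G=(V,E)$ with vertex set $V=\{x_1,\dots,x_n\}$ and edge set $E\subset V\times V$. Here, as vertices, $x_1,\dots,x_n$ are just symbols (equivalently, the indices $1,\dots,n$), while for a vector $x\in B_n$, $x_i\in\{0,1\}$ denotes its $i$-th entry. The subset of $B_n$ ordered by $G$ is $$B_n^G := \{ x\in B_n \mid \forall (x_i, x_j)\in E,\ x_i=1 \Rightarrow x_j=1 \}.$$ The partial order $G$ is valid with respect to minimization of $\phi: B_n\to\mathbb{R}$ if $\min\{\phi(x) \mid x \in B_n\} = \min\{\phi(x) \mid x \in B_n^G\}$. Note that $G$ is only required to be a directed acyclic graph (no transitivity of $E$ is required). *)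

(* Defs.v *)
From HB Require Import structures.
From mathcomp Require Import all_boot all_order all_algebra.
From mathcomp Require Import reals.

Set Implicit Arguments.
Unset Strict Implicit.
Unset Printing Implicit Defensive.

Import Order.TTheory GRing.Theory Num.Theory.
Local Open Scope ring_scope.

Definition B (n : nat) := {ffun 'I_n -> bool}.

Definition ones (n : nat) : B n := [ffun=> true].

(* The empty sequence is vacuously a [cycle]; a self-loop (i, i) is the cycle
   [:: i]. Cycles with repeated vertices are excluded as well, which amounts to
   the same since every closed walk contains a simple cycle. *)
Definition acyclic (n : nat) (E : {set 'I_n * 'I_n}) : Prop :=
  forall s : seq 'I_n, cycle (fun i j => (i, j) \in E) s -> s = [::].

Definition ordered_by (n : nat) (E : {set 'I_n * 'I_n}) : {set B n} :=
  [set x : B n | [forall e in E, x e.1 ==> x e.2]].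

(* The all-ones vector is only the starting point that [arg min] requires: the
   value is the minimum of f over A whenever [ones n \in A], which holds for
   the full cube and for [ordered_by E] (see [ones_ordered_by], [min_onP]). *)
Definition min_on (R : realType) (n : nat) (A : {set B n}) (f : B n -> R) : R :=
  f [arg min_(x < ones n in A) f x]%O.

Definition valid_for_min (R : realType) (n : nat) (E : {set 'I_n * 'I_n})
    (phi : B n -> R) : Prop :=
  min_on [set: B n] phi = min_on (ordered_by E) phi.

Definition penalized (R : realType) (n : nat) (E : {set 'I_n * 'I_n})
    (phi : B n -> R) (c : 'I_n * 'I_n -> B n -> R) (x : B n) : R :=
  phi x + \sum_(e in E) c e x * ((x e.1)%:R - (x e.1)%:R * (x e.2)%:R).

Lemma ones_ordered_by (n : nat) (E : {set 'I_n * 'I_n}) :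
  ones n \in ordered_by E.
Proof. by rewrite inE; apply/forall_inP => e _; rewrite !ffunE. Qed.

Lemma min_onP (R : realType) (n : nat) (A : {set B n}) (f : B n -> R) :
  ones n \in A ->
  (exists2 x, x \in A & f x = min_on A f) /\
  (forall x, x \in A -> min_on A f <= f x).
Proof.
by move=> A1; rewrite /min_on; case: arg_minP => // x Ax min_x; split=> //; exists x.
Qed.

(* Main.v *)
(* The penalty terms are non-negative on the whole cube and vanish on the subset
   ordered by G.  Hence the penalized function dominates phi everywhere and
   agrees with it at a minimizer of phi over the ordered subset, which by
   validity is a global minimizer of phi. *)
Require Import Defs.
From mathcomp Require Import all_boot all_order all_algebra.
From mathcomp Require Import reals.
Import Order.TTheory GRing.Theory Num.Theory.
Local Open Scope ring_scope.

(** On bits, the factor $x_i - x_i x_j$ is 1 if $x_i = 1$ and $x_j = 0$, and 0 otherwise. *)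
Lemma le_penalized (R : realType) (n : nat) (E : {set 'I_n * 'I_n})
    (phi : B n -> R) (c : 'I_n * 'I_n -> B n -> R) (x : B n) :
  (forall e, e \in E -> 0 <= c e x) -> phi x <= penalized E phi c x.
Proof.
move=> c_ge0; rewrite /penalized lerDl; apply: sumr_ge0 => e eE.
apply: mulr_ge0; first exact: c_ge0.
by case: (x e.1); case: (x e.2); rewrite ?mul0r ?mulr0 ?mulr1 ?subrr ?subr0.
Qed.

Lemma penalized_ordered_by (R : realType) (n : nat) (E : {set 'I_n * 'I_n})
    (phi : B n -> R) (c : 'I_n * 'I_n -> B n -> R) (x : B n) :
  x \in ordered_by E -> penalized E phi c x = phi x.
Proof.
rewrite inE => /forall_inP ordx; rewrite /penalized big1 ?addr0 // => e eE.
(* The one case with a nonzero factor, $x_i = 1$ and $x_j = 0$, contradicts [ordx]. *)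
by have := ordx e eE; case: (x e.1); case: (x e.2);
  rewrite // ?mul0r ?mulr1 subrr mulr0.
Qed.

Theorem proposition1 (R : realType) (n : nat) (hn : (0 < n)%N)
    (phi : B n -> R) (E : {set 'I_n * 'I_n})
    (hacyclic : acyclic E) (hvalid : valid_for_min E phi)
    (c : 'I_n * 'I_n -> B n -> R)
    (hc : forall e x, e \in E -> 0 <= c e x) :
  min_on [set: B n] phi = min_on [set: B n] (penalized E phi c) /\
  (forall xstar : B n,
     penalized E phi c xstar = min_on [set: B n] (penalized E phi c) ->
     phi xstar = min_on [set: B n] phi).
Proof.
have [_ min_phi] := @min_onP R n [set: B n] phi (in_setT _).
have [[z ord_z phi_z] _] := @min_onP R n _ phi (ones_ordered_by E).
have [[w _ pen_w] min_pen] :=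
  @min_onP R n [set: B n] (penalized E phi c) (in_setT _).
have le_pen x : phi x <= penalized E phi c x.
  by apply: le_penalized => e; apply: hc.
have eq_min : min_on [set: B n] phi = min_on [set: B n] (penalized E phi c).
  apply/eqP; rewrite eq_le; apply/andP; split.
    by rewrite -pen_w; apply: le_trans (le_pen w); apply: min_phi.
  (* Validity makes the ordered minimizer [z] global for [phi]; no penalty is paid at [z]. *)
  rewrite hvalid -phi_z -(penalized_ordered_by _ _ _ phi c _ ord_z).
  exact: min_pen.
split=> // x pen_x; apply/eqP; rewrite eq_le; apply/andP; split.
  (* With the two minima equal, [le_pen] at [x] bounds [phi x] by the minimum of [phi]. *)
  by rewrite eq_min -pen_x.
exact: min_phi.
Qed.
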